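(* Let $f$ be a probability density kernel on $\mathbb{Y}\times\mathbb{X}$. Then for any kernel $k$ on $\mathbb{Y}$, the function $$k_f(x_1,x_2):=\iint_{\mathbb{Y}\times\mathbb{Y}}k(y_1,y_2)f(y_1;x_1)f(y_2;x_2)\,dy_1\,dy_2$$ is a kernel on $\mathbb{X}$ such that, for all random probability measures $\tilde P_1,\tilde P_2$ on $\mathbb{X}$ defined on the same probability space, $\mathrm{Cov}_k(f_{\tilde P_1},f_{\tilde P_2})=\mathrm{Cov}_{k_f}(\tilde P_1,\tilde P_2)$. Moreover, if the family $\{f(\cdot;x)\}_{x\in\mathbb{X}}$ is identifiable and $k$ is characteristic, then $k_f$ is characteristic.
   Context: $\mathbb{X}$ (latent space) and $\mathbb{Y}$ (observation space) are locally compact Polish spaces with their Borel $\sigma$-algebras; $\mathbb{Y}$ carries a reference $\sigma$-finite measure denoted $dy$. A probability density kernel $f$ on $\mathbb{Y}\times\mathbb{X}$ is a jointly measurable function $(y,x)\mapsto f(y;x)\ge0$ with $\int_{\mathbb{Y}}f(y;x)\,dy=1$ for every $x\in\mathbb{X}$. For a probability measure $P$ on $\mathbb{X}$ the mixture density is $f_P(y)=\int_{\mathbb{X}}f(y;x)\,dP(x)$, identified with the probability measure $f_P(y)\,dy$ on $\mathbb{Y}$; thus $f_{\tilde P}$ is a random probability on $\mathbb{Y}$ when $\tilde P$ is one on $\mathbb{X}$. The family $\{f(\cdot;x)\}_x$ is identifiable if, for all $P_1,P_2\in\mathcal{P}(\mathbb{X})$, $f_{P_1}=f_{P_2}$ a.e.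 (w.r.t. $dy$) implies $P_1=P_2$. For a space $\mathbb{S}\in\{\mathbb{X},\mathbb{Y}\}$: $\mathcal{P}(\mathbb{S})$ is the set of probability measures on $\mathbb{S}$, with the $\sigma$-algebra generated by evaluations $\xi\mapsto\xi(A)$; a kernel on $\mathbb{S}$ is a measurable function $k:\mathbb{S}\times\mathbb{S}\to\mathbb{R}$ that is bounded, symmetric and positive-definite ($\sum_{i,j}a_ia_jk(s_i,s_j)\ge0$ for all finite families); $\mathbb{H}_k$ is its reproducing kernel Hilbert space; the kernel mean embedding of a finite signed measure $\xi$ is $\mu_k(\xi)\in\mathbb{H}_k$, $\mu_k(\xi)(t)=\int k(s,t)\,d\xi(s)$, with $\langle\mu_k(\xi_1),\mu_k(\xi_2)\rangle_{\mathbb{H}_k}=\iint k\,d\xi_1\,d\xi_2$; $k$ is characteristic if $\mu_k$ is injective on $\mathcal{P}(\mathbb{S})$. A random probability on $\mathbb{S}$ is a random element of $\mathcal{P}(\mathbb{S})$, and $\mathrm{Cov}_k(\tilde Q_1,\tilde Q_2)=\mathbb{E}\big[\langle\mu_k(\tilde Q_1)-\mathbb{E}[\mu_k(\tilde Q_1)],\mu_k(\tilde Q_2)-\mathbb{E}[\mu_k(\tilde Q_2)]\rangle_{\mathbb{H}_k}\big]$, where $\mathbb{E}[V]$ is characterised by $\langle h,\mathbb{E}[V]\rangle=\mathbb{E}\langle h,V\rangle$ for all $h\in\mathbb{H}_k$. *)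

(* Defs.v *)
From HB Require Import structures.
From mathcomp Require Import all_boot all_order all_algebra.
From mathcomp Require Import all_classical all_reals all_analysis.
From mathcomp Require Import measurable_realfun giry.

Set Implicit Arguments.
Unset Strict Implicit.
Unset Printing Implicit Defensive.

Import Order.TTheory GRing.Theory Num.Theory.
Import numFieldNormedType.Exports.

Local Open Scope classical_set_scope.
Local Open Scope measure_display_scope.
Local Open Scope ring_scope.

Definition borel (T : ptopologicalType) : measurableType (@open T).-sigma :=
  g_sigma_algebraType (@open T).

Definition separable (T : topologicalType) :=
  exists2 D : set T, countable D & dense D.

Definition completely_metrizable (R : realType) (T : topologicalType) :=
  exists (M : metricType R) (g : T -> M),
    [/\ bijective g,
        forall A : set M, open (g @^-1` A) <-> open A &
        forall F : set_system M, ProperFilter F -> cauchy F ->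
          exists x : M, F --> x].

Definition polish (R : realType) (T : topologicalType) :=
  separable T /\ completely_metrizable R T.

Definition is_kernel d (S : measurableType d) (R : realType)
    (k : S -> S -> R) :=
  [/\ measurable_fun setT (fun p : S * S => k p.1 p.2),
      exists M : R, forall s t, `|k s t| <= M,
      forall s t, k s t = k t s &
      forall (n : nat) (a : 'I_n -> R) (s : 'I_n -> S),
        0 <= \sum_(i < n) \sum_(j < n) a i * a j * k (s i) (s j)].

(* A reproducing kernel Hilbert space of k, presented as a Hilbert space whose
   elements are identified with functions on S through the injection rkhs_fun;
   it is unique up to isometry. *)
Record rkhs (R : realType) (S : Type) (k : S -> S -> R) := RKHS {
  rkhs_space :> completeNormedModType R ;
  rkhs_dot : {dot rkhs_space for idfun} ;
  rkhs_fun : {linear rkhs_space -> (S -> R^o)} ;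
  rkhs_dotE : forall h, `|h| ^+ 2 = rkhs_dot h h ;
  rkhs_fun_inj : injective rkhs_fun ;
  rkhs_reproducing : forall s, exists2 ks, rkhs_fun ks = k s &
    forall h, rkhs_fun h s = rkhs_dot h ks
}.

Section mean_embedding.
Context d (S : measurableType d) (R : realType) (k : S -> S -> R).

Definition mean_embedding (P : probability S R) : S -> R :=
  fun t => \int[P]_s k s t.

(* Measures of the library are functions on all sets, with arbitrary values on
   the nonmeasurable ones; equality of measures is therefore ≡μ. *)
Definition characteristic :=
  forall P1 P2 : probability S R,
    mean_embedding P1 = mean_embedding P2 -> P1 ≡μ P2.

Variable H : rkhs k.

(* The element of H whose underlying function is mean_embedding P; it exists and
   is unique for a bounded measurable k. *)
Definition rkhs_embedding (P : probability S R) : H :=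
  xget 0 [set h : H | rkhs_fun H h = mean_embedding P].

Context dO (Omega : measurableType dO) (Pr : probability Omega R).

(* The weak (Pettis) expectation of V. Uniqueness is automatic; the default
   value 0 is taken only when no such vector exists. *)
Definition rkhs_mean (V : Omega -> H) : H :=
  xget 0 [set m : H | forall h,
    ((rkhs_dot H h m)%:E = 'E_Pr[fun w => rkhs_dot H h (V w)])%E].

Definition rkhs_cov (Q1 Q2 : {mfun Omega >-> pprobability S R}) : \bar R :=
  let V1 w := rkhs_embedding (Q1 w) in
  let V2 w := rkhs_embedding (Q2 w) in
  ('E_Pr[fun w => rkhs_dot H (V1 w - rkhs_mean V1)%R (V2 w - rkhs_mean V2)%R])%E.

End mean_embedding.

Record density_kernel dX dY (X : measurableType dX) (Y : measurableType dY)
    (R : realType) (nu : {sigma_finite_measure set Y -> \bar R}) :=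
  DensityKernel {
    density_fun :> Y -> X -> R ;
    measurable_density : measurable_fun setT
      (fun p : Y * X => density_fun p.1 p.2) ;
    density_ge0 : forall y x, 0 <= density_fun y x ;
    integral_density : forall x, (\int[nu]_y (density_fun y x)%:E = 1)%E
  }.
Arguments density_kernel {dX dY} X {Y R} nu.

Section mixture.
Context dX dY (X : measurableType dX) (Y : measurableType dY) (R : realType).
Context (nu : {sigma_finite_measure set Y -> \bar R}).
Variable f : density_kernel X nu.
Local Open Scope ereal_scope.

(* Extended-real valued: finite for nu-almost every y only. *)
Definition mix_density (P : probability X R) (y : Y) : \bar R :=
  \int[P]_x (f y x)%:E.

Definition mixture (P : probability X R) (A : set Y) : \bar R :=
  \int[nu]_(y in A) mix_density P y.

Lemma mix_density_ge0 P y : 0 <= mix_density P y.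
Proof. by apply: integral_ge0 => x _; rewrite lee_fin density_ge0. Qed.

Lemma measurable_mix_density P : measurable_fun setT (mix_density P).
Proof.
apply: (@measurable_fun_fubini_tonelli_F _ _ _ _ _ P
  (fun p : Y * X => (f p.1 p.2)%:E)) => [|p].
  by apply/measurable_EFinP; exact: measurable_density.
by rewrite lee_fin density_ge0.
Qed.

Lemma mixtureE P A : measurable A ->
  mixture P A = \int[P]_x \int[nu]_(y in A) (f y x)%:E.
Proof.
move=> mA; rewrite /mixture integral_mkcond.
pose g (p : Y * X) := (f p.1 p.2)%:E * (\1_A p.1)%:E.
have g0 p : 0 <= g p by rewrite mule_ge0// lee_fin ?density_ge0.
have mg : measurable_fun setT g.
  apply: emeasurable_funM.
    by apply/measurable_EFinP; exact: measurable_density.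
  by apply/measurable_EFinP; apply: measurableT_comp.
transitivity (\int[nu]_y \int[P]_x g (y, x)).
  apply: eq_integral => y _; rewrite patchE /g/= indicE.
  case: ifPn => yA; first by under [RHS]eq_integral do rewrite mule1.
  by under [RHS]eq_integral do rewrite mule0; rewrite integral0.
rewrite (fubini_tonelli g)//; apply: eq_integral => x _.
rewrite [RHS]integral_mkcond; apply: eq_integral => y _.
by rewrite patchE /g/= indicE; case: ifPn => yA; rewrite ?mule1 ?mule0.
Qed.

Section measure.
Variable P : probability X R.

Lemma mixture0 : mixture P set0 = 0.
Proof. by rewrite /mixture integral_set0. Qed.

Lemma mixture_ge0 A : 0 <= mixture P A.
Proof. by apply: integral_ge0 => y _; exact: mix_density_ge0. Qed.

Lemma mixture_sigma_additive : semi_sigma_additive (mixture P).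
Proof.
have d_ge0 := mix_density_ge0 P; have d_meas := measurable_mix_density P.
move=> F mF tF mUF; rewrite /mixture ge0_integral_bigcup//=.
- apply: is_cvg_nneseries => n _ _; exact: integral_ge0.
- exact: measurable_funTS.
Qed.

HB.instance Definition _ := isMeasure.Build dY Y R (mixture P)
  mixture0 mixture_ge0 mixture_sigma_additive.

Lemma mixture_setT : mixture P setT = 1.
Proof.
rewrite mixtureE//; under eq_integral do rewrite integral_density.
rewrite integral_cst// mul1e; exact: probability_setT.
Qed.

HB.instance Definition _ := Measure_isProbability.Build dY Y R (mixture P)
  mixture_setT.

End measure.

Context dO (Omega : measurableType dO).
Variable P : {mfun Omega >-> pprobability X R}.

Definition random_mixture (w : Omega) : pprobability Y R := mixture (P w).

Lemma measurable_random_mixture : measurable_fun setT random_mixture.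
Proof.
apply: (measurability (@pset _ _ _ : set (set (pprobability Y R)))) => //.
move=> _ -[_ [r r01] [B mB <-]] <-; apply: emeasurable_fun_infty_o => //=.
pose g x := \int[nu]_(y in B) (f y x)%:E.
rewrite (_ : (fun _ => _) = (fun w => \int[P w]_x g x)); last first.
  by apply/funext => w; rewrite -mixtureE.
have mP : measurable_fun setT (P : Omega -> pprobability X R) by [].
apply: (measurable_fun_integral_kernel (measurable_kernel (kprobability mP))).
  by move=> x; apply: integral_ge0 => y _; rewrite lee_fin density_ge0.
pose h (p : Y * X) := (f p.1 p.2)%:E * (\1_B p.1)%:E.
rewrite (_ : g = fubini_G nu h); last first.
  apply/funext => x; rewrite /g integral_mkcond; apply: eq_integral => y _.
  by rewrite patchE /h/= indicE; case: ifPn => yB; rewrite ?mule1 ?mule0.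
apply: measurable_fun_fubini_tonelli_G => [|p].
  apply: emeasurable_funM.
    by apply/measurable_EFinP; exact: measurable_density.
  by apply/measurable_EFinP; apply: measurableT_comp.
by rewrite mule_ge0// lee_fin ?density_ge0.
Qed.

HB.instance Definition _ := isMeasurableFun.Build _ _ _ _ random_mixture
  measurable_random_mixture.

Definition identifiable :=
  forall P1 P2 : probability X R,
    {ae nu, forall y, mix_density P1 y = mix_density P2 y} -> P1 ≡μ P2.

End mixture.

Definition pulled_kernel dX dY (X : measurableType dX) (Y : measurableType dY)
    (R : realType) (nu : {sigma_finite_measure set Y -> \bar R})
    (f : density_kernel X nu) (k : Y -> Y -> R) : X -> X -> R :=
  fun x1 x2 => \int[(nu \x nu)%E]_p (k p.1 p.2 * f p.1 x1 * f p.2 x2).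

(* Main.v *)
(* Write [k(P, Q)] for the double integral of [k] against [P] and [Q]. Fubini
   gives [k_f(P, Q) = k(f_P, f_Q)] for all probabilities, and everything is read
   off this identity.

   Positivity of [k_f] is that of the matrices [k(P_i, P_j)]: averaging
   [sum_ij c_i c_j k(s_i, s_j) >= 0] over independent samples [s_i], with [N]
   samples of each law, gives [N^2] times the form plus [O(N)].

   In any Hilbert space of [k], mean embeddings exist by the Riesz theorem and
   satisfy [<mu(P), mu(Q)> = k(P, Q)], so the integrand defining the covariance
   is, pointwise in [w], an expression in the numbers [k(Q_i(w), Q_j(w'))]; these
   agree for [k] at the mixtures and for [k_f] at the mixing measures.

   If [P1] and [P2] have the same embedding for [k_f], then the form of [k]
   vanishes at [f_P1 - f_P2], and the Cauchy-Schwarz inequality against Dirac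
   masses makes the embeddings of [f_P1] and [f_P2] equal. *)

Require Import Defs.
From HB Require Import structures.
From mathcomp Require Import all_boot all_order all_algebra.
From mathcomp Require Import all_classical all_reals all_analysis.
From mathcomp Require Import measurable_realfun ring lra.

Set Implicit Arguments.
Unset Strict Implicit.
Unset Printing Implicit Defensive.
Import Order.TTheory GRing.Theory Num.Theory.
Import numFieldNormedType.Exports.

Local Open Scope classical_set_scope.
Local Open Scope ring_scope.

(** * Integrals of bounded measurable functions against probabilities *)

Section bounded_measurable.
Context (R : realType).

Definition bounded_measurable d (T : measurableType d) (g : T -> R) :=
  measurable_fun setT g /\ exists M, forall x, `|g x| <= M.

(** The shift makes [g] nonnegative, so that Tonelli applies; against a probability the constant
    integrates to itself and can be subtracted afterwards. *)
Lemma bounded_measurable_ge d (T : measurableType d) (g : T -> R) :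
  bounded_measurable g -> exists2 M, 0 <= M & forall x, 0 <= g x + M.
Proof.
move=> [_ [M gM]]; exists `|M| => // x.
have := gM x; have := ler_norm (- g x); have := ler_norm M; rewrite normrN; lra.
Qed.

Lemma bounded_measurable_comp d d' (T : measurableType d)
    (T' : measurableType d') (g : T -> R) (u : T' -> T) :
  measurable_fun setT u -> bounded_measurable g ->
  bounded_measurable (g \o u).
Proof.
move=> mu [mg [M gM]]; split; first exact: measurableT_comp.
by exists M => x; exact: gM.
Qed.

Lemma bounded_measurableD_cst d (T : measurableType d) (g : T -> R) (c : R) :
  bounded_measurable g -> bounded_measurable (fun x => g x + c).
Proof.
move=> [mg [M gM]]; split; first exact: measurable_funD.
by exists (M + `|c|) => x; rewrite (le_trans (ler_normD _ _))// lerD2r.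
Qed.

Section probability_integral.
Context d (T : measurableType d) (P : probability T R).
Implicit Types g : T -> R.

Lemma bounded_measurable_integrable g : bounded_measurable g ->
  P.-integrable setT (EFin \o g).
Proof.
move=> [mg [M gM]]; apply: measurable_bounded_integrable => //.
  by rewrite -ge0_fin_numE// fin_num_measure.
exists M; split; first exact: num_real.
by move=> M' MM' x _ /=; rewrite (le_trans (gM x))// ltW.
Qed.

Lemma EFin_Rintegral g : bounded_measurable g ->
  (\int[P]_x g x)%:E = (\int[P]_x (g x)%:E)%E.
Proof.
move=> /bounded_measurable_integrable ig.
by rewrite fineK//; exact: integrable_fin_num.
Qed.

Lemma Rintegral_cst_probability (c : R) : \int[P]_x c = c.
Proof.
rewrite Rintegral_cst//; have -> : fine (P setT) = 1 by rewrite probability_setT.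
by rewrite mulr1.
Qed.

Lemma RintegralD_cst g (c : R) : bounded_measurable g ->
  \int[P]_x (g x + c) = \int[P]_x g x + c.
Proof.
move=> bg; rewrite RintegralD ?Rintegral_cst_probability//.
  exact: bounded_measurable_integrable.
by apply: bounded_measurable_integrable; split => //; exists `|c|.
Qed.

Lemma normr_Rintegral_le g M : measurable_fun setT g ->
  (forall x, `|g x| <= M) -> `|\int[P]_x g x| <= M.
Proof.
move=> mg gM; have bg : bounded_measurable g by split => //; exists M.
rewrite (le_trans (le_normr_Rintegral _ _))//.
  exact: bounded_measurable_integrable.
rewrite -[leRHS]Rintegral_cst_probability le_Rintegral//.
- apply: bounded_measurable_integrable; split.
    exact: measurableT_comp.
  by exists M => x; rewrite normr_id.
- by apply: bounded_measurable_integrable; split => //; exists `|M|.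
Qed.

End probability_integral.

Lemma Rintegral_dirac d (T : measurableType d) (a : T) (g : T -> R) :
  measurable_fun setT g -> \int[dirac a]_x g x = g a.
Proof.
move=> mg; rewrite /Rintegral integral_dirac//; last exact/measurable_EFinP.
by rewrite diracT mul1e.
Qed.

Section parametric.
Context d1 d2 (T1 : measurableType d1) (T2 : measurableType d2).
Variable g : T1 * T2 -> R.
Hypothesis bg : bounded_measurable g.

Lemma bounded_measurable_section1 y : bounded_measurable (fun x => g (x, y)).
Proof. exact: (bounded_measurable_comp (u := pair^~ y)). Qed.

Lemma bounded_measurable_section2 x : bounded_measurable (fun y => g (x, y)).
Proof. exact: (bounded_measurable_comp (u := pair x)). Qed.

Lemma Rintegral_fubini (P1 : probability T1 R) (P2 : probability T2 R) :
  \int[P1]_x \int[P2]_y g (x, y) = \int[P2]_y \int[P1]_x g (x, y).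
Proof.
congr fine.
have -> : (fun x => (\int[P2]_y g (x, y))%:E) =
    (fun x => \int[P2]_y (g (x, y))%:E)%E.
  apply/funext => x; rewrite EFin_Rintegral//.
  exact: bounded_measurable_section2.
have -> : (fun y => (\int[P1]_x g (x, y))%:E) =
    (fun y => \int[P1]_x (g (x, y))%:E)%E.
  apply/funext => y; rewrite EFin_Rintegral//.
  exact: bounded_measurable_section1.
apply: (@Fubini _ _ _ _ _ _ _ (EFin \o g)).
exact: (@bounded_measurable_integrable _ _ (P1 \x P2)%E).
Qed.

Lemma bounded_measurable_Rintegral1 (P1 : probability T1 R) :
  bounded_measurable (fun y => \int[P1]_x g (x, y)).
Proof.
have [mg [M gM]] := bg; split; last first.
  exists M => y; apply: normr_Rintegral_le => //.
  by have [] := bounded_measurable_section1 y.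
have [N N0 gN] := bounded_measurable_ge bg.
rewrite (_ : (fun y => _) =
    (fun y => fine (fubini_G P1 (fun p => (g p + N)%:E) y) - N)).
  apply: measurable_funB => //; apply: measurableT_comp => //.
  apply: measurable_fun_fubini_tonelli_G => //.
  by apply/measurable_EFinP; exact: measurable_funD.
apply/funext => y; rewrite /fubini_G -[fine _]/(\int[P1]_x (g (x, y) + N)).
by rewrite RintegralD_cst ?addrK//; exact: bounded_measurable_section1.
Qed.

Lemma bounded_measurable_Rintegral2 (P2 : probability T2 R) :
  bounded_measurable (fun x => \int[P2]_y g (x, y)).
Proof.
have [mg [M gM]] := bg; split; last first.
  exists M => x; apply: normr_Rintegral_le => //.
  by have [] := bounded_measurable_section2 x.
have [N N0 gN] := bounded_measurable_ge bg.
rewrite (_ : (fun x => _) =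
    (fun y => fine (fubini_F P2 (fun p => (g p + N)%:E) y) - N)).
  apply: measurable_funB => //; apply: measurableT_comp => //.
  apply: measurable_fun_fubini_tonelli_F => //.
  by apply/measurable_EFinP; exact: measurable_funD.
apply/funext => x; rewrite /fubini_F -[fine _]/(\int[P2]_y (g (x, y) + N)).
by rewrite RintegralD_cst ?addrK//; exact: bounded_measurable_section2.
Qed.

End parametric.

Lemma bounded_measurable_Rintegral_kernel d dO (T : measurableType d)
    (Omega : measurableType dO) (Q : {mfun Omega >-> pprobability T R})
    (g : T -> R) : bounded_measurable g ->
  bounded_measurable (fun w => \int[Q w]_x g x).
Proof.
move=> bg; have [mg [M gM]] := bg; split; last first.
  by exists M => w; exact: normr_Rintegral_le.
have [N N0 gN] := bounded_measurable_ge bg.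
rewrite (_ : (fun w => _) =
    (fun w => fine (\int[Q w]_x (g x + N)%:E)%E - N)).
  apply: measurable_funB => //; apply: measurableT_comp => //.
  have mQ : measurable_fun setT (Q : Omega -> pprobability T R) by [].
  apply: (measurable_fun_integral_kernel (measurable_kernel (kprobability mQ))).
    by move=> x; rewrite lee_fin.
  by apply/measurable_EFinP; exact: measurable_funD.
apply/funext => w; rewrite -[fine _]/(\int[Q w]_x (g x + N)).
by rewrite RintegralD_cst ?addrK.
Qed.

End bounded_measurable.

(** * Integration against mixtures *)

Section mixture_integral.
Context dX dY (X : measurableType dX) (Y : measurableType dY) (R : realType).
Context (nu : {sigma_finite_measure set Y -> \bar R}) (f : density_kernel X nu).
Implicit Types (P : probability X R) (g : Y -> R).

(** The law with density [f y x] in [y], written as a mixture over a Dirac mass so as to inherit the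
    probability structure. *)
Definition point_mixture (x : X) : probability Y R := mixture f (dirac x).

Lemma mixture_dominates P : mixture f P `<< nu.
Proof.
apply/null_content_dominatesP => A mA nuA0.
rewrite /= /mixture; apply: null_set_integral => //.
exact: measurable_funTS (measurable_mix_density f P).
Qed.

(** The Radon-Nikodym derivative of the mixture and [mix_density] have the same integral over every
    measurable set, hence agree [nu]-almost everywhere. *)
Lemma integral_mixture P g : bounded_measurable g ->
  (\int[mixture f P]_y (g y)%:E =
   \int[nu]_y ((g y)%:E * mix_density f P y))%E.
Proof.
move=> bg; have [mg _] := bg.
have dom := mixture_dominates P.
rewrite -(Radon_Nikodym_change_of_variables dom)//; last first.
  exact: bounded_measurable_integrable.
have mf := measurable_mix_density f P.
have mRN : measurable_fun setT
    (Radon_Nikodym (charge_of_finite_measure (mixture f P)) nu).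
  by apply: measurable_int; exact: Radon_Nikodym_integrable.
apply: ae_eq_integral => //.
- by apply: emeasurable_funM => //; exact/measurable_EFinP.
- by apply: emeasurable_funM => //; exact/measurable_EFinP.
apply: ae_eqe_mul2l; apply: integral_ae_eq => //.
  exact: Radon_Nikodym_integrable.
by move=> E _ mE; rewrite -Radon_Nikodym_integral.
Qed.

Lemma mix_density_dirac x y : mix_density f (dirac x) y = (f y x)%:E.
Proof.
rewrite /mix_density integral_dirac//; first by rewrite diracT mul1e.
apply/measurable_EFinP.
exact: (measurableT_comp (measurable_density f) (measurable_pair1 y)).
Qed.

Lemma integral_point_mixture x g : bounded_measurable g ->
  (\int[point_mixture x]_y (g y)%:E = \int[nu]_y (g y * f y x)%:E)%E.
Proof.
move=> bg; rewrite integral_mixture//; apply: eq_integral => y _.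
by rewrite mix_density_dirac.
Qed.

Let gf g (p : Y * X) := (g p.1 * f p.1 p.2)%:E.

Let measurable_gf g : measurable_fun setT g -> measurable_fun setT (gf g).
Proof.
move=> mg; apply/measurable_EFinP; apply: measurable_funM.
  exact: measurableT_comp.
exact: measurable_density.
Qed.

Lemma integral_mixture_ge0 P g : bounded_measurable g -> (forall y, 0 <= g y) ->
  (\int[mixture f P]_y (g y)%:E =
   \int[P]_x \int[point_mixture x]_y (g y)%:E)%E.
Proof.
move=> bg g0; rewrite integral_mixture//; have [mg _] := bg.
transitivity (\int[nu]_y \int[P]_x gf g (y, x))%E.
  apply: eq_integral => y _; rewrite /mix_density -ge0_integralZl//=.
  - apply/measurable_EFinP.
    exact: (measurableT_comp (measurable_density f) (measurable_pair1 y)).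
  - by move=> x _; rewrite lee_fin density_ge0.
  - by rewrite lee_fin.
rewrite fubini_tonelli//; last 2 first.
  exact: measurable_gf.
  by move=> p; rewrite lee_fin mulr_ge0// density_ge0.
by apply: eq_integral => x _; rewrite integral_point_mixture.
Qed.

Lemma bounded_measurable_point_mixture g : bounded_measurable g ->
  bounded_measurable (fun x => \int[point_mixture x]_y g y).
Proof.
move=> bg; have [mg [M gM]] := bg; split; last first.
  by exists M => x; exact: normr_Rintegral_le.
have [N N0 gN] := bounded_measurable_ge bg.
have bgN := bounded_measurableD_cst N bg.
rewrite (_ : (fun x => _) =
    (fun x => fine (fubini_G nu (gf (fun y => g y + N)) x) - N)).
  apply: measurable_funB => //; apply: measurableT_comp => //.
  apply: measurable_fun_fubini_tonelli_G.
    by apply: measurable_gf; case: bgN.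
  by move=> p; rewrite lee_fin mulr_ge0// density_ge0.
apply/funext => x; rewrite /fubini_G -integral_point_mixture//.
by rewrite -[fine _]/(\int[point_mixture x]_y (g y + N)) RintegralD_cst// addrK.
Qed.

Lemma Rintegral_mixture P g : bounded_measurable g ->
  \int[mixture f P]_y g y = \int[P]_x \int[point_mixture x]_y g y.
Proof.
move=> bg; have [mg [M gM]] := bg.
have [N N0 gN] := bounded_measurable_ge bg.
have bgN := bounded_measurableD_cst N bg.
apply: (@addIr _ N); rewrite -!RintegralD_cst//; last first.
  exact: bounded_measurable_point_mixture.
rewrite {1}/Rintegral integral_mixture_ge0//; congr fine.
by apply: eq_integral => x _; rewrite -RintegralD_cst// EFin_Rintegral.
Qed.

End mixture_integral.

(** * The kernel [k_f] as a double integral against point mixtures *)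

Section pulled_kernel.
Context dX dY (X : measurableType dX) (Y : measurableType dY) (R : realType).
Context (nu : {sigma_finite_measure set Y -> \bar R}) (f : density_kernel X nu).

Let uff (u : Y * Y -> R) (q : (X * X) * (Y * Y)) :=
  u q.2 * f q.2.1 q.1.1 * f q.2.2 q.1.2.

Let measurable_uff u : measurable_fun setT u -> measurable_fun setT (uff u).
Proof.
move=> mu; apply: measurable_funM; first apply: measurable_funM.
- exact: measurableT_comp.
- apply: (measurableT_comp (measurable_density f)
    (g := fun q : (X * X) * (Y * Y) => (q.2.1, q.1.1))).
  apply: measurable_fun_pair => /=.
    exact: (measurableT_comp measurable_fst measurable_snd).
  exact: (measurableT_comp measurable_fst measurable_fst).
- apply: (measurableT_comp (measurable_density f)
    (g := fun q : (X * X) * (Y * Y) => (q.2.2, q.1.2))).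
  apply: measurable_fun_pair => /=.
    exact: (measurableT_comp measurable_snd measurable_snd).
  exact: (measurableT_comp measurable_snd measurable_fst).
Qed.

Let uff_ge0 u : (forall p, 0 <= u p) -> forall q, 0 <= uff u q.
Proof. by move=> u0 q; rewrite !mulr_ge0// density_ge0. Qed.

Let integral_uff u x1 x2 : bounded_measurable u -> (forall p, 0 <= u p) ->
  (\int[nu \x nu]_p (uff u ((x1, x2), p))%:E =
   (\int[point_mixture f x2]_t \int[point_mixture f x1]_s u (s, t))%:E)%E.
Proof.
move=> bu u0; have [mu _] := bu.
rewrite (fubini_tonelli2 (fun p => (uff u ((x1, x2), p))%:E)); last 2 first.
  apply/measurable_EFinP.
  exact: (measurableT_comp (measurable_uff mu) (measurable_pair1 _)).
  by move=> p; rewrite lee_fin uff_ge0.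
have b1 t : bounded_measurable (fun s => u (s, t)).
  exact: bounded_measurable_section1.
have b2 : bounded_measurable (fun t => \int[point_mixture f x1]_s u (s, t)).
  exact: bounded_measurable_Rintegral1.
rewrite EFin_Rintegral// integral_point_mixture//.
apply: eq_integral => t _; rewrite EFinM EFin_Rintegral//.
rewrite integral_point_mixture// -ge0_integralZr//=.
- apply/measurable_EFinP; apply: measurable_funM; first by have [] := b1 t.
  exact: (measurableT_comp (measurable_density f) (measurable_pair2 x1)).
- by move=> s _; rewrite lee_fin mulr_ge0// density_ge0.
- by rewrite lee_fin density_ge0.
Qed.

Let integrable_uff u x1 x2 : bounded_measurable u -> (forall p, 0 <= u p) ->
  (nu \x nu)%E.-integrable setT (fun p => (uff u ((x1, x2), p))%:E).
Proof.
move=> bu u0; have [mu _] := bu; apply/integrableP; split.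
  apply/measurable_EFinP.
  exact: (measurableT_comp (measurable_uff mu) (measurable_pair1 _)).
under eq_integral do rewrite gee0_abs ?lee_fin ?uff_ge0//.
by rewrite integral_uff// ltry.
Qed.

Variable k : Y -> Y -> R.
Hypothesis bk : bounded_measurable (fun p => k p.1 p.2).

(** Tonelli is applied to the nonnegative [k + N]. The constant [N] contributes exactly [N], because
    the densities integrate to one. *)
Let pulled_kernel_shift : exists N : R,
  [/\ forall x1 x2, pulled_kernel f k x1 x2 = fine
        (\int[nu \x nu]_p (uff (fun p => k p.1 p.2 + N)%R ((x1, x2), p))%:E)%E - N,
      bounded_measurable (fun p => k p.1 p.2 + N) &
      forall p, 0 <= k p.1 p.2 + N].
Proof.
have [mk [M kM]] := bk.
have [N N0 kN] := bounded_measurable_ge bk; exists N.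
have bkN := bounded_measurableD_cst N bk.
have bN : bounded_measurable (fun _ : Y * Y => N) by split => //; exists `|N|.
split => // x1 x2.
have -> : pulled_kernel f k x1 x2 = \int[(nu \x nu)%E]_p
    (uff (fun p => k p.1 p.2 + N) ((x1, x2), p) - uff (fun=> N) ((x1, x2), p)).
  apply: eq_Rintegral => p _; rewrite /uff/=; ring.
rewrite RintegralB//; [|exact: integrable_uff..].
congr (_ - _); rewrite /Rintegral integral_uff//=.
by rewrite !Rintegral_cst_probability.
Qed.

Lemma pulled_kernelE x1 x2 : pulled_kernel f k x1 x2 =
  \int[point_mixture f x2]_t \int[point_mixture f x1]_s k s t.
Proof.
have [N [-> bkN kN0]] := pulled_kernel_shift; rewrite integral_uff//=.
rewrite -[RHS](addrK N); congr (_ - _); rewrite -RintegralD_cst; last first.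
  exact: (bounded_measurable_Rintegral1 bk).
apply: eq_Rintegral => t _; rewrite RintegralD_cst//.
exact: (bounded_measurable_section1 bk).
Qed.

Lemma bounded_measurable_pulled_kernel :
  bounded_measurable (fun p => pulled_kernel f k p.1 p.2).
Proof.
have [mk [M kM]] := bk; split; last first.
  exists M => p; rewrite pulled_kernelE; apply: normr_Rintegral_le.
    by have [] := bounded_measurable_Rintegral1 bk (point_mixture f p.1).
  move=> t; apply: normr_Rintegral_le => [|s]; last exact: (kM (s, t)).
  by have [] := bounded_measurable_section1 bk t.
have [N [kE [mkN _] kN0]] := pulled_kernel_shift.
pose v (q : (X * X) * (Y * Y)) := (uff (fun p => k p.1 p.2 + N) q)%:E.
have mv : measurable_fun setT v.
  by apply/measurable_EFinP; apply: (measurable_uff mkN).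
have v0 q : (0 <= v q)%E by rewrite lee_fin uff_ge0.
(* [G] integrates out the first observation, leaving the second to another Tonelli step. *)
pose G (r : (X * X) * Y) := fubini_F nu (fun z => v (z.1.1, (z.2, z.1.2))) r.
have mG : measurable_fun setT G.
  apply: measurable_fun_fubini_tonelli_F => //.
  apply: (measurableT_comp mv).
  apply: measurable_fun_pair.
    exact: (measurableT_comp measurable_fst measurable_fst).
  apply: measurable_fun_pair => //.
  exact: (measurableT_comp measurable_snd measurable_fst).
have G0 r : (0 <= G r)%E by exact: integral_ge0.
rewrite (_ : (fun p => _) = (fun p => fine (fubini_F nu G p) - N)).
  apply: measurable_funB => //; apply: (measurableT_comp (fine_measurable _)) => //.
  exact: measurable_fun_fubini_tonelli_F.
apply/funext => -[x1 x2]; rewrite kE (fubini_tonelli2 (fun p => v ((x1, x2), p)))//.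
exact: (measurableT_comp mv (measurable_pair1 _)).
Qed.

End pulled_kernel.

(** * Positivity of the double-integral form *)

Section kernel_form.
Context d (S : measurableType d) (R : realType) (k : S -> S -> R).

(** This will be the inner product of the mean embeddings of [P] and [Q], written without choosing a
    Hilbert space. *)
Definition kernel_form (P Q : probability S R) : R :=
  \int[Q]_t mean_embedding k P t.

Hypothesis kk : is_kernel k.
Implicit Types P Q : probability S R.

Lemma kernel_bounded_measurable : bounded_measurable (fun p => k p.1 p.2).
Proof. by have [mk [M kM] _ _] := kk; split => //; exists M => p. Qed.

Let bk := kernel_bounded_measurable.

Lemma bounded_measurable_mean_embedding P :
  bounded_measurable (mean_embedding k P).
Proof. exact: (bounded_measurable_Rintegral1 bk). Qed.

Lemma kernel_formC P Q : kernel_form P Q = kernel_form Q P.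
Proof.
have [_ _ kC _] := kk.
rewrite /kernel_form /mean_embedding -(Rintegral_fubini bk)/=.
by apply: eq_Rintegral => s _; apply: eq_Rintegral => t _; rewrite kC.
Qed.

Lemma kernel_form_diracr P t : kernel_form P (dirac t) = mean_embedding k P t.
Proof.
rewrite /kernel_form Rintegral_dirac//.
by have [] := bounded_measurable_mean_embedding P.
Qed.

Lemma mean_embedding_dirac s t : mean_embedding k (dirac s) t = k s t.
Proof.
rewrite /mean_embedding (Rintegral_dirac s (g := k^~ t))//.
by have [] := bounded_measurable_section1 bk t.
Qed.

(** Such a functional is the average of its values at Dirac masses, so nonnegativity there gives
    nonnegativity everywhere. *)
Definition integral_functional (L : probability S R -> R) :=
  exists2 phi : S -> R, bounded_measurable phi &
    forall P, L P = \int[P]_s phi s.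

Lemma integral_functional_cst (c : R) : integral_functional (fun=> c).
Proof.
exists (fun=> c) => [|P]; last by rewrite Rintegral_cst_probability.
by split => //; exists `|c|.
Qed.

Lemma integral_functionalD L1 L2 :
  integral_functional L1 -> integral_functional L2 ->
  integral_functional (fun P => L1 P + L2 P).
Proof.
move=> [g1 b1 L1E] [g2 b2 L2E]; exists (fun s => g1 s + g2 s) => [|P].
  move: b1 b2 => [m1 [M1 gM1]] [m2 [M2 gM2]]; split; first exact: measurable_funD.
  by exists (M1 + M2) => s; rewrite (le_trans (ler_normD _ _))// lerD.
by rewrite RintegralD ?L1E ?L2E//; exact: bounded_measurable_integrable.
Qed.

Lemma integral_functionalZ (c : R) L :
  integral_functional L -> integral_functional (fun P => c * L P).
Proof.
move=> [g bg LE]; exists (fun s => c * g s) => [|P].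
  move: bg => [mg [M gM]]; split; first exact: measurable_funM.
  by exists (`|c| * M) => s; rewrite normrM ler_wpM2l.
by rewrite LE RintegralZl//; exact: bounded_measurable_integrable.
Qed.

Lemma integral_functional_sum (I : finType) (L : I -> probability S R -> R) :
  (forall i, integral_functional (L i)) ->
  integral_functional (fun P => \sum_i L i P).
Proof.
move=> iL; elim: (index_enum I) => [|i r IH].
  rewrite (_ : (fun P => _) = fun=> 0); first exact: integral_functional_cst.
  by apply/funext => P; rewrite big_nil.
rewrite (_ : (fun P => _) = fun P => L i P + \sum_(j <- r) L j P).
  exact: integral_functionalD.
by apply/funext => P; rewrite big_cons.
Qed.

(* Expectation of the form sum_ij c_i c_j k(s_i, s_j) for independent s_i of
   laws P_i. *)
Definition sampled_form (I : finType) (c : I -> R) (P : I -> probability S R) :=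
  \sum_i \sum_j c i * c j *
    (if i == j then \int[P i]_s k s s else kernel_form (P i) (P j)).

(** A diagonal term holds its law in a single integral, and an off-diagonal term meets [i0] at most
    once. With [kernel_form] on the diagonal the dependence on [mu] would be quadratic. *)
Lemma integral_functional_sampled_form (I : finType) (c : I -> R)
    (Ps : I -> probability S R) (i0 : I) :
  integral_functional
    (fun mu => sampled_form c (fun i => if i == i0 then mu else Ps i)).
Proof.
apply: integral_functional_sum => i; apply: integral_functional_sum => j.
apply: integral_functionalZ.
case: (eqVneq i j) => [_|ij].
  case: (eqVneq i i0) => _; last exact: integral_functional_cst.
  exists (fun s => k s s) => //.
  apply: (bounded_measurable_comp (u := fun s => (s, s))) bk.
  exact: measurable_fun_pair.
case: (eqVneq i i0) => [ii0|_]; case: (eqVneq j i0) => [ji0|_].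
- by rewrite ii0 ji0 eqxx in ij.
- exists (mean_embedding k (Ps j)) => [|Q]; last by rewrite kernel_formC.
  exact: bounded_measurable_mean_embedding.
- exists (mean_embedding k (Ps i)) => //.
  exact: bounded_measurable_mean_embedding.
- exact: integral_functional_cst.
Qed.

(* The form is affine in each P_i, so its sign may be checked on Dirac masses,
   one index at a time. *)
Lemma sampled_form_ge0 (I : finType) (c : I -> R) (P : I -> probability S R) :
  0 <= sampled_form c P.
Proof.
(* Indices in [r] carry their law, the others a point. The points stay arbitrary in the induction,
   since each step lets one of them vary. *)
suff H (r : seq I) (s : I -> S) :
    0 <= sampled_form c (fun i => if i \in r then P i else dirac (s i)).
  have := H (index_enum I) (fun=> point).
  rewrite (_ : (fun i => _) = P)//.
  by apply/funext => i; rewrite mem_index_enum.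
elim: r s => [|x r IH] s.
  rewrite (_ : sampled_form _ _ = \sum_i \sum_j c i * c j * k (s i) (s j)).
    have [_ _ _ kpos] := kk.
    have := kpos #|I| (fun i => c (enum_val i)) (fun i => s (enum_val i)).
    rewrite [in X in _ -> X]big_enum_val/=.
    congr (0 <= _); apply: eq_bigr => i _.
    by rewrite [RHS]big_enum_val.
  apply: eq_bigr => i _; apply: eq_bigr => j _; congr (_ * _).
  case: eqVneq => [->|_] /=; last by rewrite kernel_form_diracr mean_embedding_dirac.
  rewrite (Rintegral_dirac (s j) (g := fun s => k s s))//.
  have [mk _] := bk.
  apply: (measurableT_comp (g := fun s => (s, s)) mk).
  exact: measurable_fun_pair.
have [xr|xr] := boolP (x \in r).
  rewrite (_ : (fun i => _) = fun i => if i \in r then P i else dirac (s i))//.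
  apply/funext => i; rewrite inE; case: eqVneq => [->|//]; by rewrite xr.
pose Q i := if i \in r then P i else dirac (s i) : probability S R.
rewrite (_ : (fun i => _) = fun i => if i == x then P x else Q i); last first.
  by apply/funext => i; rewrite inE /Q; case: eqVneq => [->|].
(* In the law at [x] the form is the integral of [phi], and [phi t] is its value at the Dirac mass
   at [t], which the induction hypothesis covers. *)
have [phi [mphi _] phiE] := integral_functional_sampled_form c Q x.
rewrite phiE Rintegral_ge0// => t _.
rewrite -(Rintegral_dirac t mphi) -phiE.
have := IH (fun i => if i == x then t else s i).
congr (0 <= sampled_form _ _); apply/funext => i; rewrite /Q.
by case: eqVneq => [->|//]; rewrite (negbTE xr).
Qed.

(* Sampling each law N times gives N^2 times the form plus a diagonal
   correction of order N. *)
Lemma kernel_form_ge0 n (a : 'I_n -> R) (P : 'I_n -> probability S R) :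
  0 <= \sum_(i < n) \sum_(j < n) a i * a j * kernel_form (P i) (P j).
Proof.
set F := \sum_(i < n) _.
(* On the diagonal each sample contributes a single integral instead of the form; [E] totals these
   discrepancies over one sample of each law. *)
pose E := \sum_(i < n) a i * a i *
  (\int[P i]_s k s s - kernel_form (P i) (P i)).
have NF (N : nat) : 0 <= N%:R ^+ 2 * F + N%:R * E.
  have := @sampled_form_ge0 ('I_n * 'I_N)%type (fun p => a p.1) (fun p => P p.1).
  congr (0 <= _); rewrite /sampled_form.
  transitivity (\sum_(p : 'I_n * 'I_N) ((\sum_(q : 'I_n * 'I_N)
      a p.1 * a q.1 * kernel_form (P p.1) (P q.1)) +
      a p.1 * a p.1 * (\int[P p.1]_s k s s - kernel_form (P p.1) (P p.1)))).
    apply: eq_bigr => p _; rewrite (bigD1 p)//= eqxx.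
    rewrite [in RHS](bigD1 p)//= addrAC -mulrDr addrCA subrr addr0.
    congr (_ + _); apply: eq_bigr => q; rewrite eq_sym => /negbTE ->//.
  rewrite big_split/=; congr (_ + _).
    rewrite -(pair_bigA _ (fun i l => \sum_(q : 'I_n * 'I_N)
      a i * a q.1 * kernel_form (P i) (P q.1)))/=.
    rewrite mulr_sumr; apply: eq_bigr => i _.
    rewrite sumr_const card_ord -[LHS]mulr_natl expr2 -[RHS]mulrA; congr (_ * _).
    rewrite -(pair_bigA _ (fun j l => a i * a j * kernel_form (P i) (P j)))/=.
    rewrite mulr_sumr; apply: eq_bigr => j _.
    by rewrite sumr_const card_ord -[LHS]mulr_natl.
  rewrite -(pair_bigA _ (fun i l => a i * a i *
    (\int[P i]_s k s s - kernel_form (P i) (P i))))/=.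
  rewrite mulr_sumr; apply: eq_bigr => i _.
  by rewrite sumr_const card_ord -[LHS]mulr_natl.
rewrite leNgt; apply/negP => F0.
have F0' : 0 < - F by rewrite oppr_gt0.
(* With this [N], [N * F + E < 0], which contradicts [NF] after division by [N]. *)
pose N := (Num.truncn (`|E| / (- F))).+1.
have EN : `|E| < N%:R * (- F) by rewrite -ltr_pdivrMr// truncnS_gt.
have N0 : (0 : R) < N%:R by rewrite ltr0n.
have := NF N; rewrite expr2 -mulrA -mulrDr pmulr_rge0//.
have := ler_norm E; lra.
Qed.

(** At [x * (P - Q) + dirac t] the form is quadratic in [x], with the expression assumed zero as
    leading coefficient. It is thus affine and nonnegative on the whole line, so its slope, twice
    the difference of the embeddings at [t], vanishes. *)
Lemma mean_embedding_eq P Q :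
  kernel_form P P - 2 * kernel_form P Q + kernel_form Q Q = 0 ->
  mean_embedding k P = mean_embedding k Q.
Proof.
move=> PQ0; apply/funext => t; apply/eqP; rewrite -subr_eq0; apply/eqP.
set D := _ - _.
have H (x : R) : 0 <= 2 * x * D + k t t.
  have := @kernel_form_ge0 3 (fun i => nth 0 [:: x; - x; 1] i)
    (fun i => nth P [:: P; Q; dirac t : probability S R] i).
  rewrite !big_ord_recl !big_ord0/=.
  rewrite (kernel_formC (dirac t) P) (kernel_formC (dirac t) Q).
  rewrite (kernel_formC Q P) !kernel_form_diracr mean_embedding_dirac.
  suff -> : 2 * x * D + k t t = x ^+ 2 *
    (kernel_form P P - 2 * kernel_form P Q + kernel_form Q Q) + 2 * x * D + k t t.
    by congr (0 <= _); rewrite /D; ring.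
  by rewrite PQ0 mulr0 add0r.
apply/eqP/negPn/negP => D0.
(* This choice of [x] would give the affine function the value [-1]. *)
have := H (- (k t t + 1) / (2 * D)).
rewrite (_ : 2 * _ * D = - (k t t + 1)); first by lra.
by field.
Qed.

End kernel_form.

(** * Transfer between [k] and [k_f] *)

Section mixture_kernel_form.
Context dX dY (X : measurableType dX) (Y : measurableType dY) (R : realType).
Context (nu : {sigma_finite_measure set Y -> \bar R}) (f : density_kernel X nu).
Variable k : Y -> Y -> R.
Hypothesis kk : is_kernel k.
Implicit Types P Q : probability X R.

Lemma pulled_kernel_form x1 x2 : pulled_kernel f k x1 x2 =
  kernel_form k (point_mixture f x1) (point_mixture f x2).
Proof. exact: pulled_kernelE (kernel_bounded_measurable kk) _ _. Qed.

Lemma is_kernel_pulled_kernel : is_kernel (pulled_kernel f k).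
Proof.
have [mkf [M kfM]] :=
  bounded_measurable_pulled_kernel f (kernel_bounded_measurable kk).
split => //.
- by exists M => s t; exact: (kfM (s, t)).
- by move=> s t; rewrite !pulled_kernel_form kernel_formC.
- move=> n a s; have := kernel_form_ge0 kk a (fun i => point_mixture f (s i)).
  congr (0 <= _); apply: eq_bigr => i _; apply: eq_bigr => j _.
  by rewrite pulled_kernel_form.
Qed.

Lemma mean_embedding_pulled_kernel P x : mean_embedding (pulled_kernel f k) P x =
  kernel_form k (mixture f P) (point_mixture f x).
Proof.
rewrite kernel_formC// /kernel_form Rintegral_mixture; last first.
  exact: bounded_measurable_mean_embedding.
by apply: eq_Rintegral => x' _; rewrite pulled_kernel_form kernel_formC.
Qed.

(** The mixing measures are unfolded one at a time: [mean_embedding_pulled_kernel] handles the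
    first, [Rintegral_mixture] the second. *)
Lemma kernel_form_mixture P Q : kernel_form (pulled_kernel f k) P Q =
  kernel_form k (mixture f P) (mixture f Q).
Proof.
rewrite /kernel_form Rintegral_mixture; last first.
  exact: bounded_measurable_mean_embedding.
by apply: eq_Rintegral => x _; rewrite mean_embedding_pulled_kernel.
Qed.

Lemma characteristic_pulled_kernel : identifiable f -> characteristic k ->
  characteristic (pulled_kernel f k).
Proof.
move=> idf kchar P1 P2 P12.
have form12 Q : kernel_form k (mixture f P1) (mixture f Q) =
                kernel_form k (mixture f P2) (mixture f Q).
  by rewrite -!kernel_form_mixture /kernel_form P12.
have /kchar fP12 :
    mean_embedding k (mixture f P1) = mean_embedding k (mixture f P2).
  (* By [form12] and symmetry the three values of the form coincide, and [1 - 2 + 1 = 0]. *)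
  apply: mean_embedding_eq => //.
  rewrite (form12 P1) (form12 P2) kernel_formC// form12; ring.
apply: idf.
have mf P := measurable_mix_density f P.
(* Equal mixtures mean equal integrals of the densities over all measurable sets, hence densities
   equal almost everywhere. *)
suff H : ae_eq nu setT (mix_density f P1) (mix_density f P2).
  by apply: filterS H => y; exact.
apply: integral_ae_eq => //; last by move=> E _ mE; exact: fP12.
apply/integrableP; split => //.
under eq_integral do rewrite gee0_abs ?mix_density_ge0//.
by rewrite -[ltLHS]/(mixture f P1 setT) mixture_setT ltry.
Qed.

End mixture_kernel_form.

(** * Hilbert space geometry and Riesz representation *)

Section hilbert.
Context (R : realType) (S : Type) (k : S -> S -> R) (H : rkhs k).
Local Notation dot := (rkhs_dot H).
Implicit Types (u v w : H) (a : R).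

Lemma rkhs_dotC u v : dot u v = dot v u.
Proof. by rewrite hermC/= expr0 mul1r. Qed.

Lemma rkhs_dotDr u v w : dot u (v + w) = dot u v + dot u w.
Proof. exact: linearDr. Qed.

Lemma rkhs_dotZr a u v : dot u (a *: v) = a * dot u v.
Proof. exact: linearZr_LR. Qed.

Lemma rkhs_dotDl u v w : dot (u + v) w = dot u w + dot v w.
Proof. by rewrite rkhs_dotC rkhs_dotDr !(rkhs_dotC w). Qed.

Lemma rkhs_dotZl a u v : dot (a *: u) v = a * dot u v.
Proof. by rewrite rkhs_dotC rkhs_dotZr (rkhs_dotC v). Qed.

Lemma rkhs_dotBr u v w : dot u (v - w) = dot u v - dot u w.
Proof. by rewrite -scaleN1r rkhs_dotDr rkhs_dotZr mulN1r. Qed.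

Lemma rkhs_dotBl u v w : dot (u - v) w = dot u w - dot v w.
Proof. by rewrite rkhs_dotC rkhs_dotBr !(rkhs_dotC w). Qed.

Lemma rkhs_dot_ge0 u : 0 <= dot u u.
Proof. by rewrite -rkhs_dotE sqr_ge0. Qed.

Lemma rkhs_cauchy_schwarz u v : `|dot u v| <= `|u| * `|v|.
Proof.
have [->|v0] := eqVneq v 0.
  by rewrite -(scale0r (0 : H)) rkhs_dotZr mul0r normr0 mulr_ge0.
rewrite -(@ler_pXn2r _ 2)// ?nnegrE ?mulr_ge0// real_normK ?num_real//.
(* This vector is [dot v v] times the component of [u] orthogonal to [v], which avoids a
   division. *)
have := rkhs_dot_ge0 (dot v v *: u - dot u v *: v).
rewrite !(rkhs_dotBl, rkhs_dotBr, rkhs_dotZl, rkhs_dotZr) (rkhs_dotC v u).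
rewrite exprMn !rkhs_dotE.
have : 0 < dot v v by rewrite -rkhs_dotE exprn_gt0// normr_gt0.
set x := dot u u; set y := dot v v; set z := dot u v => y0.
rewrite (_ : _ - _ = y * (x * y - z ^+ 2)); last by ring.
by rewrite pmulr_rge0// subr_ge0.
Qed.

(** The vector representing evaluation at [s] has squared norm [k s s], and Cauchy-Schwarz
    applies. *)
Lemma rkhs_fun_norm_le M : 0 <= M -> (forall s, k s s <= M ^+ 2) ->
  forall h s, `|rkhs_fun H h s| <= M * `|h|.
Proof.
move=> M0 kM h s; have [ks ksE hE] := rkhs_reproducing H s.
have ksM : `|ks| <= M.
  rewrite -(@ler_pXn2r _ 2)// ?nnegrE// rkhs_dotE -hE ksE.
  exact: kM.
by rewrite hE (le_trans (rkhs_cauchy_schwarz _ _))// mulrC ler_wpM2r.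
Qed.

(* Riesz representation on a closed subspace: the representing vector is the
   limit of a minimising sequence of |h|^2 - 2 L(h). *)
Lemma rkhs_riesz (E : set H) (L : H -> R) (C : R) :
  E 0 -> (forall a u v, E u -> E v -> E (a *: u + v)) ->
  (forall (u : nat -> H) l, (forall n, E (u n)) -> u n @[n --> \oo] --> l -> E l) ->
  (forall a u v, E u -> E v -> L (a *: u + v) = a * L u + L v) ->
  (forall u, E u -> `|L u| <= C * `|u|) ->
  exists2 m, E m & forall h, E h -> dot h m = L h.
Proof.
move=> E0 Elin Ecl Llin LC.
pose J h := dot h h - 2 * L h.
pose A := [set J h | h in E].
have A0 : A !=set0 by exists (J 0), 0.
(* Complete the square: [|h|^2 - 2 C |h| = (|h| - C)^2 - C^2]. *)
have lbA : lbound A (- C ^+ 2).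
  move=> _ [h Eh <-]; rewrite /J -rkhs_dotE.
  have := LC _ Eh; have := ler_norm (L h); have := sqr_ge0 (`|h| - C).
  rewrite sqrrB; lra.
have hiA : has_inf A by split => //; exists (- C ^+ 2).
pose I := inf A.
have JI h : E h -> I <= J h.
  by move=> Eh; apply: ge_inf; [exists (- C ^+ 2)|exists h].
have /choice[u uP] (n : nat) : exists h, E h /\ J h < I + n.+1%:R^-1.
  have n0 : (0 : R) < n.+1%:R^-1 by rewrite invr_gt0.
  by have [_ [h Eh <-] Jh] := inf_adherent n0 hiA; exists h.
have Eu n : E (u n) by have [] := uP n.
have LD g h : E g -> E h -> L (g + h) = L g + L h.
  by move=> Eg Eh; rewrite -[g]scale1r Llin// mul1r scale1r.
have L0 : L 0 = 0.
  by have := LD _ _ E0 E0; rewrite addr0 => /(congr1 (+%R^~ (- L 0)));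
    rewrite subrr addrK.
have LZ a h : E h -> L (a *: h) = a * L h.
  by move=> Eh; rewrite -[_ *: _]addr0 Llin// L0 addr0.
have EZ a h : E h -> E (a *: h).
  by move=> Eh; rewrite -[_ *: _]addr0; exact: Elin.
have ED g h : E g -> E h -> E (g + h).
  by move=> Eg Eh; rewrite -[g]scale1r; exact: Elin.
(* The midpoint of [g] and [h] lies in [E], so [J] is at least [I] there; this forces
   near-minimisers to be close to each other. *)
have parallelogram g h : E g -> E h ->
    dot (g - h) (g - h) <= 2 * (J g - I) + 2 * (J h - I).
  move=> Eg Eh; have := JI _ (EZ 2^-1 _ (ED _ _ Eg Eh)).
  rewrite /J LZ ?LD//; last exact: ED.
  rewrite !(rkhs_dotBl, rkhs_dotBr, rkhs_dotDl, rkhs_dotDr, rkhs_dotZl, rkhs_dotZr).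
  rewrite (rkhs_dotC h g); lra.
have [m um] : exists m : H, u n @[n --> \oo] --> m.
  apply/cvg_ex; apply: cauchy_cvg; apply: cauchy_exP => e e0.
  (* Each of the two terms in [parallelogram] is then below [e ^+ 2 / 2]. *)
  have e20 : 0 < e ^+ 2 / 4 by rewrite divr_gt0// exprn_gt0.
  have [N _ NP] := near_infty_natSinv_lt (PosNum e20).
  exists (u N); exists N => // n /= Nn.
  rewrite -ball_normE /ball_/= -(@ltr_pXn2r _ 2)// ?nnegrE ?(ltW e0)// rkhs_dotE.
  rewrite (le_lt_trans (parallelogram _ _ (Eu _) (Eu _)))//.
  have := NP _ Nn; have := NP N (leqnn _) => /=.
  have := (uP N).2; have := (uP n).2.
  move: (n.+1%:R^-1) (N.+1%:R^-1) (J (u n)) (J (u N)) => x y z t; lra.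
have Em : E m by apply: Ecl um.
exists m => // h Eh; apply/eqP; rewrite -subr_eq0; apply/eqP.
set D := _ - _.
(* The right-hand side is [J (m + t h) - J m]; its sign is obtained by comparing with [u n] close to
   [m], up to an error [e]. *)
have tP (t : R) : 0 <= t ^+ 2 * dot h h + 2 * t * D.
  apply/ler_addgt0Pr => e e0.
  (* [J (u n)] exceeds [I] by less than [n.+1%:R^-1], and replacing [m] by [u n] costs at most
     [2 |t| |h| |m - u n|]; [c] collects both, for a total error of at most [e / 2]. *)
  pose c := 1 + 2 * `|t| * `|h|.
  have c0 : 0 < c by rewrite /c ltr_pwDl// !mulr_ge0.
  have ec0 : 0 < e / (2 * c) by rewrite divr_gt0// mulr_gt0.
  have [n [nE nm]] : exists n, n.+1%:R^-1 < e / (2 * c) /\ `|m - u n| < e / (2 * c).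
    have [N _ NP] := near_infty_natSinv_lt (PosNum ec0).
    have [N' _ NP'] := (cvgrPdist_lt _ _).1 um _ ec0.
    exists (maxn N N'); split; first exact: (NP _ (leq_maxl _ _)).
    exact: (NP' _ (leq_maxr _ _)).
  have := JI _ (Elin t _ _ Eh (Eu n)).
  have := (uP n).2.
  rewrite /J Llin// !(rkhs_dotDl, rkhs_dotDr, rkhs_dotZl, rkhs_dotZr).
  rewrite (rkhs_dotC (u n) h).
  have : `|t * dot h (m - u n)| <= `|t| * `|h| * (e / (2 * c)).
    rewrite normrM -mulrA ler_wpM2l// (le_trans (rkhs_cauchy_schwarz _ _))//.
    by rewrite ler_wpM2l// ltW.
  rewrite ler_norml => /andP[].
  rewrite rkhs_dotBr.
  have : (1 + 2 * `|t| * `|h|) * (e / (2 * c)) = e / 2.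
    by rewrite -/c; field; rewrite gt_eqF.
  move: nE; rewrite /D; move: (e / (2 * c)) (n.+1%:R^-1) => e' p.
  rewrite -(mulrA 2 `|t|); move: (`|t| * `|h|) => T.
  move: (dot h h) (dot h m) (dot h (u n)) (dot (u n) (u n)) (L h) (L (u n)).
  move=> x y z w l l'; nra.
have h1 : 0 < dot h h + 1 by rewrite ltr_pwDr// rkhs_dot_ge0.
(* The quadratic is tested near its minimiser [- D / dot h h]; the added [1] keeps the denominator
   positive when [h = 0]. *)
have := tP (- D / (dot h h + 1)).
rewrite (_ : _ + _ = - (D / (dot h h + 1)) ^+ 2 * (dot h h + 2)); last first.
  by field; rewrite gt_eqF.
rewrite mulNr oppr_ge0 pmulr_lle0; last by have := rkhs_dot_ge0 h; lra.
move=> D0; have /eqP : (D / (dot h h + 1)) ^+ 2 = 0.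
  by apply/eqP; rewrite eq_le D0 sqr_ge0.
by rewrite sqrf_eq0 mulf_eq0 invr_eq0 (gt_eqF h1) orbF => /eqP.
Qed.

End hilbert.

(** * Mean embeddings and covariance in a Hilbert space of [k] *)

Section rkhs_embedding.
Context d (S : measurableType d) (R : realType) (k : S -> S -> R).
Hypothesis kk : is_kernel k.
Variable H : rkhs k.
Local Notation dot := (rkhs_dot H).

Let bound : exists2 M, 0 <= M & forall h s, `|rkhs_fun H h s| <= M * `|h|.
Proof.
(* The constant satisfies [(1 + |M|)^2 >= |M| >= k s s], even for small [M]. *)
have [_ [M kM] _ _] := kk; exists (1 + `|M|); first by rewrite addr_ge0.
apply: rkhs_fun_norm_le => [|s]; first by rewrite addr_ge0.
have := kM s s; have := ler_norm (k s s); have := ler_norm M.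
have := normr_ge0 M; have := sqr_ge0 `|M|; rewrite sqrrD; lra.
Qed.

Let measurable_elements := [set h : H | measurable_fun setT (rkhs_fun H h)].

Let measurable_elements_linear a u v : measurable_elements u ->
  measurable_elements v -> measurable_elements (a *: u + v).
Proof.
move=> mu mv; rewrite /measurable_elements/= linearP.
have mu' : measurable_fun setT (fun s => a * rkhs_fun H u s).
  exact: measurable_funM.
exact: (measurable_funD mu' mv).
Qed.

(** By [bound], norm convergence gives pointwise convergence, which preserves measurability. *)
Let measurable_elements_closed (u : nat -> H) l :
  (forall n, measurable_elements (u n)) -> u n @[n --> \oo] --> l ->
  measurable_elements l.
Proof.
move=> mu ul; have [M M0 hM] := bound.
apply: (measurable_fun_cvg (h := fun n => rkhs_fun H (u n))) => // s _.
apply/cvgrPdist_le => e e0.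
have M1 : 0 < M + 1 by rewrite ltr_pwDr.
have eM : 0 < e / (M + 1) by rewrite divr_gt0.
have [N _ uN] := (cvgrPdist_le _ _).1 ul _ eM; exists N => // n /uN /= un.
rewrite -[_ - _]/((rkhs_fun H l - rkhs_fun H (u n)) s) -linearB.
rewrite (le_trans (hM _ _))// (@le_trans _ _ ((M + 1) * `|l - u n|))//.
  by rewrite ler_wpM2r// lerDl.
by rewrite mulrC -ler_pdivlMr.
Qed.

Let measurable_elements0 : measurable_elements 0.
Proof. by rewrite /measurable_elements/= linear0; exact: measurable_cst. Qed.

Let measurable_section s : measurable_fun setT (k s).
Proof.
by have [] := bounded_measurable_section2 (kernel_bounded_measurable kk) s.
Qed.

(* A function of H and its projection onto the closed subspace of measurable
   functions agree everywhere, because that subspace contains the sections of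
   k. *)
Lemma bounded_measurable_rkhs_fun h : bounded_measurable (rkhs_fun H h).
Proof.
have [M _ hM] := bound; split; last by exists (M * `|h|).
have [||m Em mE] := @rkhs_riesz _ _ _ H measurable_elements (dot h) `|h|
    measurable_elements0 measurable_elements_linear measurable_elements_closed.
- by move=> a u v _ _; rewrite rkhs_dotDr rkhs_dotZr.
- by move=> u _; exact: rkhs_cauchy_schwarz.
suff -> : h = m by exact: Em.
apply: (@rkhs_fun_inj _ _ _ H); apply/funext => s.
have [ks ksE ev] := rkhs_reproducing H s.
rewrite !ev (rkhs_dotC m) mE//.
by rewrite /measurable_elements/= ksE; exact: measurable_section.
Qed.

(** Integration against [P] is a bounded linear functional on [H]; pairing its Riesz vector with the
    section at [s] gives the mean embedding at [s]. *)
Lemma rkhs_embedding_exists (P : probability S R) :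
  exists m : H, rkhs_fun H m = mean_embedding k P /\
    forall h, dot h m = \int[P]_s rkhs_fun H h s.
Proof.
have [M _ hM] := bound.
have [//|//|//|||m _ mE] := @rkhs_riesz _ _ _ H setT
    (fun h => \int[P]_s rkhs_fun H h s) M.
- move=> a u v _ _; rewrite linearP.
  have iu := bounded_measurable_integrable P (bounded_measurable_rkhs_fun u).
  have iv := bounded_measurable_integrable P (bounded_measurable_rkhs_fun v).
  rewrite -RintegralZl// -RintegralD//.
  exact: (integrableZl measurableT a iu).
- move=> u _; apply: normr_Rintegral_le => //.
  by have [] := bounded_measurable_rkhs_fun u.
exists m; split; last by move=> h; exact: mE.
apply/funext => s; have [ks ksE ->] := rkhs_reproducing H s.
have [_ _ kC _] := kk.
rewrite rkhs_dotC mE// ksE; apply: eq_Rintegral => t _; exact: kC.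
Qed.

Lemma rkhs_fun_embedding (P : probability S R) :
  rkhs_fun H (rkhs_embedding H P) = mean_embedding k P.
Proof.
have [m [mE _]] := rkhs_embedding_exists P.
by apply: (xgetPex 0 (P := [set h | rkhs_fun H h = mean_embedding k P])); exists m.
Qed.

Lemma rkhs_dot_embedding (P : probability S R) h :
  dot h (rkhs_embedding H P) = \int[P]_s rkhs_fun H h s.
Proof.
have [m [mE <-]] := rkhs_embedding_exists P; congr (dot h _).
by apply: (@rkhs_fun_inj _ _ _ H); rewrite rkhs_fun_embedding.
Qed.

Lemma rkhs_dot_embeddings (P Q : probability S R) :
  dot (rkhs_embedding H P) (rkhs_embedding H Q) = kernel_form k P Q.
Proof. by rewrite rkhs_dot_embedding rkhs_fun_embedding. Qed.

Context dO (Omega : measurableType dO) (Pr : probability Omega R).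
Implicit Types Q : {mfun Omega >-> pprobability S R}.

(** Riesz again, for the functional [h |-> E <h, mu(Q)>]: the weak expectation exists, so [xget]
    does not fall back on its default. *)
Lemma rkhs_dot_mean Q h :
  dot h (rkhs_mean Pr (fun w => rkhs_embedding H (Q w))) =
  \int[Pr]_w dot h (rkhs_embedding H (Q w)).
Proof.
have [M M0 hM] := bound.
have bQ u : bounded_measurable (fun w => dot u (rkhs_embedding H (Q w))).
  rewrite (_ : (fun w => _) = (fun w => \int[Q w]_s rkhs_fun H u s)).
    exact: bounded_measurable_Rintegral_kernel (bounded_measurable_rkhs_fun u).
  by apply/funext => w; rewrite rkhs_dot_embedding.
apply: EFin_inj; rewrite EFin_Rintegral//.
have [//|//|//|||m _ mE] := @rkhs_riesz _ _ _ H setT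
    (fun h => \int[Pr]_w dot h (rkhs_embedding H (Q w))) M.
- move=> a u v _ _.
  have iu := bounded_measurable_integrable Pr (bQ u).
  have iv := bounded_measurable_integrable Pr (bQ v).
  under eq_Rintegral do rewrite rkhs_dotDl rkhs_dotZl.
  rewrite -RintegralZl// -RintegralD//.
  exact: (integrableZl measurableT a iu).
- move=> u _; apply: normr_Rintegral_le => [|w]; first by have [] := bQ u.
  rewrite rkhs_dot_embedding; apply: normr_Rintegral_le => //.
  by have [] := bounded_measurable_rkhs_fun u.
pose A := [set m : H | forall h, ((dot h m)%:E =
  'E_Pr[fun w => dot h (rkhs_embedding H (Q w))])%E].
have : A (rkhs_mean Pr (fun w => rkhs_embedding H (Q w))).
  by apply: xgetPex; exists m => u; rewrite unlock mE// EFin_Rintegral.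
by move=> /(_ h); rewrite unlock.
Qed.

(** Bilinearity expands the product, and pairing with a weak expectation becomes an integral over
    [Pr]. The right-hand side no longer mentions [H]. *)
Lemma rkhs_covE Q1 Q2 : rkhs_cov H Pr Q1 Q2 =
  (\int[Pr]_w (kernel_form k (Q1 w) (Q2 w)
     - \int[Pr]_v kernel_form k (Q1 w) (Q2 v)
     - (\int[Pr]_v kernel_form k (Q2 w) (Q1 v)
     - \int[Pr]_v \int[Pr]_u kernel_form k (Q2 v) (Q1 u)))%:E)%E.
Proof.
rewrite /rkhs_cov unlock; apply: eq_integral => w _; congr EFin.
set m1 := rkhs_mean _ _; set m2 := rkhs_mean _ _.
have dot_mean1 w' : dot (rkhs_embedding H (Q2 w')) m1 =
    \int[Pr]_v kernel_form k (Q2 w') (Q1 v).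
  rewrite rkhs_dot_mean; apply: eq_Rintegral => v _.
  by rewrite rkhs_dot_embeddings.
rewrite rkhs_dotBl !rkhs_dotBr rkhs_dot_embeddings.
congr (_ - _ - (_ - _)).
- rewrite rkhs_dot_mean; apply: eq_Rintegral => v _.
  by rewrite rkhs_dot_embeddings.
- by rewrite rkhs_dotC dot_mean1.
- rewrite rkhs_dot_mean; apply: eq_Rintegral => v _.
  by rewrite rkhs_dotC dot_mean1.
Qed.

End rkhs_embedding.

Theorem theorem14 (R : realType) (X Y : ptopologicalType)
  (lcX : locally_compact [set: X]) (polX : polish R X)
  (lcY : locally_compact [set: Y]) (polY : polish R Y)
  (nu : {sigma_finite_measure set (borel Y) -> \bar R})
  (f : density_kernel (borel X) nu)
  (k : borel Y -> borel Y -> R) (kk : is_kernel k) :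
  [/\ is_kernel (pulled_kernel f k),
      forall (dO : measure_display) (Omega : measurableType dO)
        (Pr : probability Omega R)
        (P1 P2 : {mfun Omega >-> pprobability (borel X) R})
        (Hk : rkhs k) (Hkf : rkhs (pulled_kernel f k)),
        rkhs_cov Hk Pr (random_mixture f P1) (random_mixture f P2) =
        rkhs_cov Hkf Pr P1 P2 &
      identifiable f -> characteristic k ->
        characteristic (pulled_kernel f k)].
Proof.
split; first exact: is_kernel_pulled_kernel.
- move=> dO Omega Pr P1 P2 Hk Hkf.
  (* Both covariances become expressions in values of [kernel_form], which are matched term by
     term. *)
  rewrite (rkhs_covE kk) (rkhs_covE (is_kernel_pulled_kernel f kk)).
  apply: eq_integral => w _; congr (_ - _ - (_ - _))%:E.
  + by rewrite kernel_form_mixture.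
  + by apply: eq_Rintegral => v _; rewrite kernel_form_mixture.
  + by apply: eq_Rintegral => v _; rewrite kernel_form_mixture.
  + apply: eq_Rintegral => v _; apply: eq_Rintegral => u _.
    by rewrite kernel_form_mixture.
- exact: characteristic_pulled_kernel.
Qed.
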